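(* Let $A=JL\in\mathrm{GH}(2n)$ with $J\in\mathrm{SS}(2n)$ and $L\in\mathrm{SPD}(2n)$ (so $(A,B,C)$ is pure marginally stable), and let $J_\Omega=-J^{-1}$. Let $\Xi,\Xi'\in\mathrm{SPD}(n)$, $G\in\mathrm{Sp}(J_\Omega,J_{2n})$, $k\le n$, and let $(\Psi,\Phi)$ be the test and trial basis matrices of the corresponding symplectic balancing. Put $\tilde A=\Psi^{\tau}A\Phi$, $\tilde B=\Psi^{\tau}B$, $\tilde C=C\Phi$. Then: (a) The reduced system $(\tilde A,\tilde B,\tilde C)$, with test and trial basis matrices $(\Psi,\Phi)$, remains pure marginally stable, i.e. $\tilde A\in\mathrm{GH}(2k)$. (b) The reduced system $(-\tilde A^{\tau},\tilde C^{\tau},\tilde B^{\tau})$ of the negative dual system $(-A^{\tau},C^{\tau},B^{\tau})$, with test and trial basis matrices $(\Phi,\Psi)$ (so $-\tilde A^{\tau}=\Phi^{\tau}(-A^{\tau})\Psi$), remains pure marginally stable, i.e. $-\tilde A^{\tau}\in\mathrm{GH}(2k)$.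
   Context: $\mathrm{GH}(m)$: real $m\times m$ matrices that are diagonalizable (over $\mathbb{C}$) with all eigenvalues nonzero and purely imaginary; an LTI system with system matrix in $\mathrm{GH}(m)$ is called pure marginally stable. $\mathrm{SPD}(m)$: real symmetric positive-definite $m\times m$ matrices. $\mathrm{SS}(m)$: real nonsingular skew-symmetric $m\times m$ matrices. $J_{2n}=\begin{bmatrix}0&I_n\\-I_n&0\end{bmatrix}$. $\mathrm{Sp}(J_\Omega,J_\Pi)$: real full-column-rank matrices $V$ with $V^{\tau}J_\Omega V=J_\Pi$; in particular $G\in\mathrm{Sp}(J_\Omega,J_{2n})$ is invertible with $G^{\tau}J_\Omega G=J_{2n}$. $\tau$ denotes transpose. Symplectic balancing: given $\Xi,\Xi'\in\mathrm{SPD}(n)$, $J_\Omega\in\mathrm{SS}(2n)$, $G\in\mathrm{Sp}(J_\Omega,J_{2n})$ and $k\le n$, write $\Xi=RR^{\tau}$, $\Xi'=SS^{\tau}$ with $R,S\in\mathbb{R}^{n\times n}$, take a singular value decomposition $R^{\tau}S=U\Sigma V^{\tau}$ with singular values in decreasing order, let $U_1,V_1\in\mathbb{R}^{n\times k}$ be the first $k$ columns of $U,V$ and $\Sigma_1$ the diagonal matrix of the $k$ largest singular values. Put $\bar\Phi=SV_1\Sigma_1^{-1/2}$, $\bar\Psi=RU_1\Sigma_1^{-1/2}$. The trial and test basis matrices of the symplectic balancing are $\Phi=G\,\mathrm{diag}(\bar\Phi,\bar\Psi)$ and $\Psi=G^{-\tau}\,\mathrm{diag}(\bar\Psi,\bar\Phi)$,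 both in $\mathbb{R}^{2n\times2k}$. *)

(* Defs.v *)
From HB Require Import structures.
From mathcomp Require Import all_boot all_order all_algebra.
From mathcomp Require Import reals.
From mathcomp Require Import complex.

Set Implicit Arguments.
Unset Strict Implicit.
Unset Printing Implicit Defensive.

Import Order.TTheory GRing.Theory Num.Theory.

Local Open Scope ring_scope.

Section MatrixClasses.
Variable R : realType.

(* [complex.Re] is the coordinate projection R[i] -> R. *)
Definition GH (m : nat) (A : 'M[R]_m) : Prop :=
  let Ac := map_mx (real_complex R) A in
  diagonalizable Ac /\
  forall z : R[i], eigenvalue Ac z -> z != 0 /\ complex.Re z = 0.

Definition SPD (m : nat) (M : 'M[R]_m) : Prop :=
  M \is symmetricmx /\
  forall x : 'cV[R]_m, x != 0 -> 0 < (x^T *m M *m x) 0 0.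

Definition SS (m : nat) (J : 'M[R]_m) : Prop :=
  J \is skewmx /\ J \in unitmx.

(* Size 2n is written n + n throughout, to match block_mx. *)
Definition Jcan (n : nat) : 'M[R]_(n + n) :=
  block_mx 0 1%:M (- 1%:M) 0.

Definition Sp (m p : nat) (JO : 'M[R]_m) (JP : 'M[R]_p) (V : 'M[R]_(m, p)) :
    Prop :=
  \rank V = p /\ V^T *m JO *m V = JP.

Definition is_svd (n : nat) (M U : 'M[R]_n) (sigma : 'rV[R]_n) (V : 'M[R]_n) :
    Prop :=
  [/\ U^T *m U = 1%:M,
      V^T *m V = 1%:M,
      forall i, 0 <= sigma 0 i,
      forall i j : 'I_n, (i <= j)%N -> sigma 0 j <= sigma 0 i &
      M = U *m diag_mx sigma *m V^T].

Definition first_cols (m n k : nat) (kn : (k <= n)%N) (M : 'M[R]_(m, n)) :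
    'M[R]_(m, k) :=
  colsub (widen_ord kn) M.

(* Diagonal matrix with entries d_i^{-1/2}; only meaningful for d > 0. *)
Definition diag_invsqrt (k : nat) (d : 'rV[R]_k) : 'M[R]_k :=
  diag_mx (map_mx (fun x => (Num.sqrt x)^-1) d).

(* The balancing depends on the chosen factorizations and singular value
   decomposition, hence a relation: (Psi, Phi) arises from some such choice. *)
Definition symplectic_balancing (n k : nat) (kn : (k <= n)%N)
    (Xi Xi' : 'M[R]_n) (G : 'M[R]_(n + n))
    (Psi Phi : 'M[R]_(n + n, k + k)) : Prop :=
  exists (Rf Sf U V : 'M[R]_n) (sigma : 'rV[R]_n),
    [/\ Xi = Rf *m Rf^T,
        Xi' = Sf *m Sf^T,
        is_svd (Rf^T *m Sf) U sigma V &
        let D := diag_invsqrt (first_cols kn sigma) in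
        let Phib := Sf *m first_cols kn V *m D in
        let Psib := Rf *m first_cols kn U *m D in
        Phi = G *m block_mx Phib 0 0 Psib /\
        Psi = (invmx G)^T *m block_mx Psib 0 0 Phib].

End MatrixClasses.

Section Systems.
Variable R : realType.

(* x' = A x + B u, y = C x, with m states, p inputs and q outputs. *)
Record lti (m p q : nat) := LTI {
  sysA : 'M[R]_m;
  sysB : 'M[R]_(m, p);
  sysC : 'M[R]_(q, m)
}.

Definition pure_marginally_stable (m p q : nat) (S : lti m p q) : Prop :=
  GH (sysA S).

Definition negative_dual (m p q : nat) (S : lti m p q) : lti m q p :=
  LTI (- (sysA S)^T) (sysC S)^T (sysB S)^T.

(* [Psi] is the test basis matrix and [Phi] the trial basis matrix. *)
Definition reduced (m r p q : nat) (Psi Phi : 'M[R]_(m, r)) (S : lti m p q) :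
    lti r p q :=
  LTI (Psi^T *m sysA S *m Phi) (Psi^T *m sysB S) (sysC S *m Phi).

End Systems.

(* Main.v *)
Require Import Defs.
From HB Require Import structures.
From mathcomp Require Import all_boot all_order all_algebra.
From mathcomp Require Import reals.
From mathcomp Require Import complex.

(* The singular value decomposition makes the two blocks biorthogonal, so
   Psi^T Phi = 1 and, G being symplectic, Psi^T = - Jcan Phi^T JO.  As
   JO J = -1, the reduced matrix is Psi^T (J L) Phi = Jcan (Phi^T L Phi), again
   a nonsingular skew-symmetric matrix times a positive definite one.  Any such
   product is in GH: factoring the positive definite matrix over the complex
   numbers as T^* T, both J (T^* T) and (T^* T) J are similar to the invertible
   skew-Hermitian matrix T J T^*, which is unitarily diagonalizable with
   nonzero, purely imaginary eigenvalues.  The order (T^* T) J covers the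
   negative dual. *)

Set Implicit Arguments.
Unset Strict Implicit.
Unset Printing Implicit Defensive.

Import Order.TTheory GRing.Theory Num.Theory.

Local Open Scope ring_scope.

Section SkewSymmetricPositive.
Local Open Scope sesquilinear_scope.
Variable R : realType.
Local Notation toC := (map_mx (real_complex R)).

Lemma tr_skewmx m (J : 'M[R]_m) : J \is skewmx -> J^T = - J.
Proof.
by move=> /is_hermitianmxP h; rewrite {2}h map_mx_id// expr1 scaleN1r opprK.
Qed.

Lemma tr_symmetricmx m (L : 'M[R]_m) : (L \is symmetricmx) = (L^T == L).
Proof. by rewrite is_hermitianmxE map_mx_id// expr0 scale1r eq_sym. Qed.

Lemma adj_toC m n (M : 'M[R]_(m, n)) : (toC M) ^t* = toC M^T.
Proof. by apply/matrixP => i j; rewrite !mxE; exact: conjc_real. Qed.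

Lemma adj_mul m n p (M : 'M[R[i]]_(m, n)) (N : 'M[R[i]]_(n, p)) :
  (M *m N) ^t* = N ^t* *m M ^t*.
Proof. by rewrite trmx_mul map_mxM. Qed.

Lemma adj_unit m (M : 'M[R[i]]_m) : (M ^t* \in unitmx) = (M \in unitmx).
Proof. by rewrite map_unitmx unitmx_tr. Qed.

(** A skew-Hermitian [K] is normal, hence unitarily diagonalizable, and [W] transports this to [A].
    Invertibility of [K] excludes the eigenvalue 0. *)
Lemma GH_skewherm_similar m (A : 'M[R]_m) (W K : 'M[R[i]]_m) :
  W \in unitmx -> K \in unitmx -> K ^t* = - K ->
  W *m toC A = K *m W -> GH A.
Proof.
move=> Wu Ku Kskew WA; split.
  have /orthomx_spectralP KE : K \is normalmx.
    by apply/normalmxP; rewrite Kskew mulmxN mulNmx.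
  set P := spectralmx K in KE; have Pu : P \in unitmx by exact: spectral_unit.
  have PWu : P *m W \in unitmx by rewrite unitmx_mul Pu.
  exists (P *m W) => //; apply/similar_diagPex; exists (spectral_diag K).
  by apply/(similarP PWu); rewrite -mulmxA WA {1}KE !mulmxA mulmxV// mul1mx.
move=> z /eigenvalueP[v vA v0].
(* Eigenvectors are row vectors here, so multiplying by the inverse of [W] on the right turns one of
   [A] into one of [K]. *)
pose u := v *m invmx W.
have u0 : u != 0.
  by apply: contraNneq v0 => uE; rewrite -(mulmxKV Wu v) -/u uE mul0mx.
have uK : u *m K = z *: u.
  by rewrite -[K](mulmxK Wu) -WA !mulmxA mulmxKV// vA -scalemxAl.
split.
  apply: contraNneq u0 => z0.
  by rewrite -(mulmxK Ku u) uK z0 scale0r mul0mx.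
have uKa : - (K *m u ^t*) = (conjc z) *: u ^t*.
  by have := congr1 (fun M => M ^t*) uK; rewrite adj_mul Kskew mulNmx => ->;
    apply/matrixP => i j; rewrite !mxE rmorphM.
have uu0 : (u *m u ^t*) 0 0 != 0.
  by rewrite -dotmxE dnorm_eq0.
(* Evaluate [u *m K *m u ^t*] once through [uK] and once through its adjoint [uKa]; the first factor
   is twice the real part of [z]. *)
have /eqP : (z + conjc z) * (u *m u ^t*) 0 0 = 0.
  have := congr1 (mulmx u) uKa.
  rewrite mulmxN mulmxA uK -scalemxAr -scalemxAl => /matrixP/(_ 0 0).
  by rewrite !mxE mulrDl => <-; rewrite subrr.
by rewrite mulf_eq0 (negPf uu0) orbF addcJ mulf_eq0 pnatr_eq0/= => /eqP[].
Qed.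

Lemma SPD_unit m (L : 'M[R]_m) : SPD L -> L \in unitmx.
Proof.
move=> [_ Lpos]; rewrite -row_free_unit -kermx_eq0; apply/rowV0P => v.
move=> /sub_kermxP vL; apply/eqP/negP => /negP v0.
have := Lpos v^T; rewrite trmxK vL mul0mx mxE ltxx trmx_eq0.
by move=> /(_ v0).
Qed.

Lemma SPD_eigenvalue_gt0 m (L : 'M[R]_m) a : SPD L -> eigenvalue L a -> 0 < a.
Proof.
move=> [_ Lpos] /eigenvalueP[v vL v0].
have dot_gt0 : 0 < (v *m v^T) 0 0.
  have vv i : true -> 0 <= v 0 i * v^T i 0 by rewrite mxE -expr2 sqr_ge0.
  rewrite mxE lt_def sumr_ge0// andbT psumr_eq0//.
  apply: contraNN v0 => /allP v_eq0; apply/eqP/rowP => i.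
  have := v_eq0 i (mem_index_enum _); rewrite !mxE/= mulf_eq0 orbb.
  by move/eqP.
have := Lpos v^T; rewrite trmx_eq0 trmxK vL -scalemxAl mxE => /(_ v0).
by rewrite pmulr_lgt0.
Qed.

(* With [P] unitary and [toC L = P^* D P], take [T = D^(1/2) P]. *)
Lemma SPD_factor m (L : 'M[R]_m) : SPD L ->
  exists2 T : 'M[R[i]]_m, T \in unitmx & toC L = T ^t* *m T.
Proof.
move=> LP; have [/[!tr_symmetricmx]/eqP Lsym _] := LP.
have Lherm : toC L \is hermsymmx.
  by apply/is_hermitianmxP; rewrite expr0 scale1r adj_toC Lsym.
have /orthomx_spectralP LE := hermitian_normalmx Lherm.
have /mxOverP dreal := hermitian_spectral_diag_real Lherm.
set P := spectralmx _ in LE; set d := spectral_diag _ in LE dreal.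
have Pun : P \is unitarymx by exact: spectral_unitarymx.
have Pu := unitarymx_unit Pun.
(* Each [d 0 i] is real and an eigenvalue of [toC L], hence of [L] itself, where positivity over the
   reals applies. The eigenvector is row [i] of [P]. *)
have d_gt0 i : 0 < d 0 i.
  have /complex_realP[a da] := dreal 0 i.
  rewrite da ltcR; apply: (SPD_eigenvalue_gt0 LP).
  rewrite -(eigenvalue_map (real_complex R)).
  suff: eigenvalue (toC L) (d 0 i) by rewrite da.
  apply/eigenvalueP; exists (row i P).
    by rewrite -row_mul LE !mulmxA mulmxV// mul1mx row_mul row_diag_mx
       -scalemxAl -rowE.
  rewrite rowE -(mul0mx _ P) (inj_eq (can_inj (mulmxK Pu))).
  by apply/eqP => /rowP/(_ i)/eqP; rewrite !mxE !eqxx oner_eq0.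
pose s := \row_i sqrtC (d 0 i).
exists (diag_mx s *m P).
  rewrite unitmx_mul Pu andbT unitmxE det_diag unitfE; apply/prodf_neq0 => i _.
  by rewrite mxE sqrtC_eq0 gt_eqF.
rewrite adj_mul {1}LE invmx_unitary// -!mulmxA; congr (_ *m _).
rewrite !mulmxA; congr (_ *m _).
rewrite tr_diag_mx map_diag_mx mulmx_diag; congr diag_mx.
apply/rowP => i; rewrite !mxE /= conj_Creal ?ger0_real ?sqrtC_ge0 ?ltW//.
by rewrite -expr2 sqrtCK.
Qed.

Section Product.
Variables (m : nat) (J L : 'M[R]_m).
Hypotheses (hJ : SS J) (hL : SPD L).

Lemma SS_SPD_skewherm : exists T : 'M[R[i]]_m,
  [/\ T \in unitmx, toC L = T ^t* *m T, T *m toC J *m T ^t* \in unitmx &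
      (T *m toC J *m T ^t*) ^t* = - (T *m toC J *m T ^t*)].
Proof.
have [T Tu LE] := SPD_factor hL; have [/tr_skewmx Jskew Ju] := hJ.
exists T; split=> //; first by rewrite !unitmx_mul adj_unit Tu map_unitmx Ju.
by rewrite !adj_mul adj_toC Jskew trmxCK map_mxN !(mulmxN, mulNmx) mulmxA.
Qed.

Lemma GH_SS_SPD : GH (J *m L).
Proof.
have [T [Tu LE Ku Kskew]] := SS_SPD_skewherm.
by apply: (GH_skewherm_similar Tu Ku Kskew); rewrite map_mxM LE !mulmxA.
Qed.

Lemma GH_SPD_SS : GH (L *m J).
Proof.
have [T [Tu LE Ku Kskew]] := SS_SPD_skewherm.
have Tau : T ^t* \in unitmx by rewrite adj_unit.
have Wu : invmx (T ^t*) \in unitmx by rewrite unitmx_inv.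
(* Both sides of the required intertwining equal [T *m toC J]. *)
apply: (GH_skewherm_similar Wu Ku Kskew).
by rewrite map_mxM LE !mulmxA mulVmx// mul1mx mulmxK.
Qed.

End Product.

Lemma Jcan_sqr n : Jcan R n *m Jcan R n = - 1%:M.
Proof.
rewrite /Jcan mulmx_block !(mul0mx, mulmx0, mul1mx, mulmx1, add0r, addr0).
by rewrite (scalar_mx_block n n 1) opp_block_mx !oppr0.
Qed.

Lemma Jcan_SS n : SS (Jcan R n).
Proof.
split; last first.
  have [] // := @mulmx1_unit _ _ (Jcan R n) (- Jcan R n).
  by rewrite mulmxN Jcan_sqr opprK.
apply/is_hermitianmxP; rewrite map_mx_id// expr1 scaleN1r /Jcan.
by rewrite tr_block_mx opp_block_mx !raddfN/= !trmx0 !trmx1 oppr0 !opprK.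
Qed.

(** The left inverse [E] makes [F] injective, so a nonzero [x] gives a nonzero [F *m x]. *)
Lemma SPD_congr m p (L : 'M[R]_m) (F : 'M[R]_(m, p)) (E : 'M[R]_(p, m)) :
  SPD L -> E *m F = 1%:M -> SPD (F^T *m L *m F).
Proof.
move=> [/[!tr_symmetricmx]/eqP Lsym Lpos] EF; split.
  by rewrite tr_symmetricmx !trmx_mul trmxK Lsym mulmxA.
move=> x x0; have := Lpos (F *m x).
rewrite trmx_mul !mulmxA; apply; apply: contraNneq x0 => Fx.
by rewrite -[x]mul1mx -EF -mulmxA Fx mulmx0.
Qed.

(** The product collapses to [D *m diag_mx (first_cols kn sigma) *m D]. Invertibility of [Rf] and
    [Sf] makes every singular value positive, so [D] inverts genuine square roots. *)
Lemma svd_biorthogonal n k (kn : (k <= n)%N) (Rf Sf U V : 'M[R]_n)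
    (sigma : 'rV[R]_n) (D := diag_invsqrt (first_cols kn sigma)) :
  Rf \in unitmx -> Sf \in unitmx -> is_svd (Rf^T *m Sf) U sigma V ->
  (Rf *m first_cols kn U *m D)^T *m (Sf *m first_cols kn V *m D) = 1%:M.
Proof.
move=> Ru Su [UU VV s_ge0 _ RSE].
have su : diag_mx sigma \in unitmx.
  have : U *m diag_mx sigma *m V^T \in unitmx.
    by rewrite -RSE unitmx_mul unitmx_tr Ru.
  by rewrite !unitmx_mul => /andP[/andP[]].
have s_gt0 i : 0 < sigma 0 i.
  rewrite lt_def s_ge0 andbT; move: su.
  by rewrite unitmxE det_diag unitfE => /prodf_neq0 ->.
have mid : (first_cols kn U)^T *m (Rf^T *m Sf) *m first_cols kn V =
    diag_mx (first_cols kn sigma).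
  (* Writing column selection as a product lets the orthogonality of [U] and [V] cancel them. *)
  have cols (M : 'M[R]_n) : first_cols kn M = M *m first_cols kn 1%:M.
    by rewrite /first_cols mulmx_colsub mulmx1.
  rewrite (cols U) (cols V) RSE trmx_mul !mulmxA -(mulmxA _ U^T U) UU mulmx1.
  rewrite -(mulmxA _ V^T V) VV mulmx1; apply/matrixP => i j.
  rewrite mul_mx_diag mxE (bigD1 (widen_ord kn i)) //= big1 ?addr0.
    by rewrite !mxE /= eqxx mul1r mulr_natr.
  by move=> l /negPf li; rewrite !mxE /= li !mul0r.
have DT : D^T = D by rewrite /D /diag_invsqrt tr_diag_mx.
rewrite !trmx_mul DT.
have -> : D *m ((first_cols kn U)^T *m Rf^T) *m (Sf *m first_cols kn V *m D) =
    D *m ((first_cols kn U)^T *m (Rf^T *m Sf) *m first_cols kn V) *m D.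
  by rewrite !mulmxA.
rewrite mid /D /diag_invsqrt !mulmx_diag; apply/matrixP => i j; rewrite !mxE.
congr (_ *+ _); set x := sigma 0 _.
have x_gt0 : 0 < x by exact: s_gt0.
by rewrite mulrAC -invfM -expr2 sqr_sqrtr ?ltW// mulVf ?gt_eqF.
Qed.

End SkewSymmetricPositive.

Theorem corollary4p21 (R : realType) (n k p q : nat) (kn : (k <= n)%N)
    (J L A : 'M[R]_(n + n)) (B : 'M[R]_(n + n, p)) (C : 'M[R]_(q, n + n))
    (hJ : SS J) (hL : SPD L) (hA : A = J *m L)
    (hstab : pure_marginally_stable (LTI A B C))
    (JO : 'M[R]_(n + n)) (hJO : JO = - invmx J)
    (Xi Xi' : 'M[R]_n) (hXi : SPD Xi) (hXi' : SPD Xi')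
    (G : 'M[R]_(n + n)) (hG : Sp JO (Jcan R n) G)
    (Psi Phi : 'M[R]_(n + n, k + k))
    (hbal : symplectic_balancing kn Xi Xi' G Psi Phi) :
  let At := Psi^T *m A *m Phi in
  let Bt := Psi^T *m B in
  let Ct := C *m Phi in
  (reduced Psi Phi (LTI A B C) = LTI At Bt Ct /\
   pure_marginally_stable (LTI At Bt Ct)) /\
  (reduced Phi Psi (negative_dual (LTI A B C)) = LTI (- At^T) Ct^T Bt^T /\
   pure_marginally_stable (LTI (- At^T) Ct^T Bt^T)).
Proof.
move=> At Bt Ct.
have [Jskew Ju] := hJ; have [GT GE] := hG.
have Gu : G \in unitmx by rewrite -row_full_unit /row_full GT.
have [Rf [Sf [U [V [sigma [XiE Xi'E hsvd [PhiE PsiE]]]]]]] := hbal.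
set D := diag_invsqrt _ in PhiE PsiE.
set Phib := Sf *m _ *m D in PhiE PsiE; set Psib := Rf *m _ *m D in PhiE PsiE.
have Ru : Rf \in unitmx.
  by have := SPD_unit hXi; rewrite XiE unitmx_mul => /andP[].
have Su : Sf \in unitmx.
  by have := SPD_unit hXi'; rewrite Xi'E unitmx_mul => /andP[].
have bi : Psib^T *m Phib = 1%:M by exact: svd_biorthogonal.
have bi' : Phib^T *m Psib = 1%:M by rewrite -[LHS]trmxK trmx_mul trmxK bi trmx1.
have PsiPhi : Psi^T *m Phi = 1%:M.
  rewrite PsiE PhiE trmx_mul trmxK mulmxA mulmxKV// tr_block_mx !trmx0.
  rewrite mulmx_block !(mul0mx, mulmx0, add0r, addr0) bi bi'.
  by rewrite -scalar_mx_block.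
(* Since [G^T *m JO *m G] is [Jcan R n], whose square is -1, the right-hand side is a left inverse
   of [G]. *)
have GVE : invmx G = - (Jcan R n *m G^T *m JO).
  by rewrite -[RHS](mulmxK Gu) mulNmx -!mulmxA (mulmxA G^T) GE Jcan_sqr opprK mul1mx.
(* The swapped diagonal blocks of [Psi] and [Phi] are what is needed here: moving [Jcan] across a
   block diagonal matrix exchanges its two blocks. *)
have PsiT : Psi^T = - (Jcan R k *m Phi^T *m JO).
  rewrite PsiE PhiE !trmx_mul trmxK GVE mulmxN !mulmxA; congr (- (_ *m _ *m _)).
  rewrite !tr_block_mx !trmx0 /Jcan !mulmx_block.
  by rewrite !(mul0mx, mulmx0, mul1mx, mulmx1, add0r, addr0, mulmxN, mulNmx).
have AtE : At = Jcan R k *m (Phi^T *m L *m Phi).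
  rewrite /At PsiT hA hJO !(mulmxN, mulNmx) opprK !mulmxA.
  by rewrite -(mulmxA _ (invmx J)) mulVmx// mulmx1.
(* [Psi^T] serves as the left inverse of [Phi]. *)
have LtP : SPD (Phi^T *m L *m Phi) by exact: SPD_congr PsiPhi.
have JcS := Jcan_SS R k.
split; split.
- by [].
- by rewrite /pure_marginally_stable /= AtE; exact: GH_SS_SPD.
- rewrite /reduced /negative_dual /=; congr LTI.
  + by rewrite mulmxN mulNmx /At !trmx_mul trmxK mulmxA.
  + by rewrite trmx_mul.
  + by rewrite trmx_mul trmxK.
(* Transposing reverses the factors and the skew factor absorbs the sign, leaving the positive
   definite factor first. *)
- have [/[!tr_symmetricmx]/eqP Ltsym _] := LtP.
  have [/tr_skewmx Jcskew _] := JcS.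
  rewrite /pure_marginally_stable /= AtE trmx_mul Jcskew Ltsym mulmxN opprK.
  exact: GH_SPD_SS.
Qed.
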